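(* Let $N$ be a lattice of rank $d$ with dual lattice $M$, and let $\sigma\subset N_{\mathbb{R}}$ be a full-dimensional strongly convex rational polyhedral cone. If the dual cone $\sigma^\vee\subset M_{\mathbb{R}}$ is $G$-stable, then $\mathcal{N}_0(\sigma)=\mathcal{N}_p(\sigma)$ for all primes $p>0$.
   Context: $M$ and $N$ are dual free abelian groups of finite rank $d$, $M_{\mathbb{R}}=M\otimes_{\mathbb{Z}}\mathbb{R}$, $N_{\mathbb{R}}=N\otimes_{\mathbb{Z}}\mathbb{R}$. ''Cone'' means strictly (strongly) convex rational polyhedral cone; it is full-dimensional if its dimension equals the rank of the lattice. $\sigma^\vee\subset M_{\mathbb{R}}$ is the dual cone of $\sigma$. For a cone $\tau\subset M_{\mathbb{R}}$: $G(\tau)$ is the minimal generating set (Hilbert basis) of the semigroup $\tau\cap M$; $\Gamma_+(\tau)=\operatorname{Conv}((\tau\cap M)\setminus\{0\})$; $\Gamma(\tau)$ is the union of the compact faces of the polyhedron $\Gamma_+(\tau)$. For $A\subset M$, $\sigma_A=\operatorname{Cone}(A)$ is the cone generated by $A$ in $M_{\mathbb{R}}$. The cone $\tau$ is $G$-stable if (i) $G(\tau)=\Gamma(\tau)\cap M$, and (ii) $G(\sigma_A)=G(\tau)\cap\sigma_A$ for every $A\subset G(\tau)$. Fix a $\mathbb{Z}$-basis of $M$. For $h_1,\dots,h_d\in M$ let $(h_1\cdots h_d)$ be the matrix with columns $h_i$, and set $\det_0(h_1\cdots h_d)=\det(h_1\cdots h_d)$ and, for $p$ prime, $\det_p(h_1\cdots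 h_d)=\det(h_1\cdots h_d) \bmod p$. For $p=0$ or $p$ prime, define the polyhedron $$\mathcal{N}_p(\sigma)=\operatorname{Conv}\big\{(h_1+\dots+h_d)+\sigma^\vee \mid h_i\in G(\sigma^\vee)\text{ and }\det_p(h_1\cdots h_d)\neq 0\big\},$$ i.e. the convex hull of the union of these translates of $\sigma^\vee$. *)

(* Defs.v *)
From HB Require Import structures.
From mathcomp Require Import all_boot all_order all_algebra.
From mathcomp Require Import all_classical all_reals all_analysis.
Import Order.TTheory GRing.Theory Num.Theory.
Import numFieldNormedType.Exports.

Set Implicit Arguments.
Unset Strict Implicit.
Unset Printing Implicit Defensive.

Local Open Scope classical_set_scope.
Local Open Scope ring_scope.

(** A Z-basis of M is fixed, with its dual basis of N: both lattices are
    'rV[int]_d, both real vector spaces are 'rV[R]_d, and the duality pairing is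
    the standard one. *)

Section Defs.
Variables (R : realType) (d : nat).
Implicit Types (A X P F tau sigma : set 'rV[R]_d) (H S : set 'rV[int]_d).

Definition of_lattice (m : 'rV[int]_d) : 'rV[R]_d := map_mx intr m.

Definition lattice_points X : set 'rV[int]_d := of_lattice @^-1` X.

Definition pairing (m n : 'rV[R]_d) : R := \sum_(i < d) m 0 i * n 0 i.

Definition cone_gen A : set 'rV[R]_d :=
  [set x | exists (k : nat) (c : 'I_k -> R) (a : 'I_k -> 'rV[R]_d),
     [/\ forall i, 0 <= c i, forall i, A (a i) & x = \sum_(i < k) c i *: a i]].

Definition rational_polyhedral_cone sigma : Prop :=
  exists s : seq 'rV[int]_d, sigma = cone_gen (of_lattice @` [set` s]).

Definition strongly_convex sigma : Prop :=
  forall x, sigma x -> sigma (- x) -> x = 0.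

Definition is_linear_span A (U : {vspace 'rV[R]_d}) : Prop :=
  A `<=` [set` U] /\
  forall V : {vspace 'rV[R]_d}, A `<=` [set` V] -> (U <= V)%VS.

Definition has_dimension sigma (k : nat) : Prop :=
  exists2 U : {vspace 'rV[R]_d}, is_linear_span sigma U & \dim U = k.

Definition full_dimensional sigma : Prop := has_dimension sigma d.

Definition dual_cone sigma : set 'rV[R]_d :=
  [set m | forall n, sigma n -> 0 <= pairing m n].

(* As usual for affine semigroups, 0 is the empty sum, so it is never needed as
   a generator. *)
Definition generates S H : Prop :=
  S = [set m | exists s : seq 'rV[int]_d, [set` s] `<=` H /\ m = \sum_(h <- s) h].

(* The intersection of all generating sets: it is the minimal generating set
   as soon as there is a least one, which is the case when tau is a strongly
   convex rational polyhedral cone. *)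
Definition hilbert_basis tau : set 'rV[int]_d :=
  smallest (generates (lattice_points tau)) set0.

Definition convex_hull A : set 'rV[R]_d := smallest (@convex_set R 'rV[R]_d) A.

Definition Gamma_plus tau : set 'rV[R]_d :=
  convex_hull (of_lattice @` (lattice_points tau `\ 0)).

(* Taking u = 0 and b = 0 makes P a face of itself. *)
Definition is_face P F : Prop :=
  exists (u : 'rV[R]_d) (b : R),
    (forall x, P x -> b <= pairing x u) /\ F = P `&` [set x | pairing x u = b].

Definition Gamma tau : set 'rV[R]_d :=
  \bigcup_(F in [set F | is_face (Gamma_plus tau) F /\ compact F]) F.

Definition G_stable tau : Prop :=
  hilbert_basis tau = lattice_points (Gamma tau) /\
  forall S, S `<=` hilbert_basis tau ->
    let sigma_S := cone_gen (of_lattice @` S) in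
    hilbert_basis sigma_S = hilbert_basis tau `&` lattice_points sigma_S.

Definition columns (h : 'I_d -> 'rV[int]_d) : 'M[int]_d :=
  \matrix_(i < d, j < d) h j 0 i.

(* For p = 0 this is the determinant itself, since (m %% 0)%Z = m. *)
Definition det_mod (p : nat) (B : 'M[int]_d) : int := (\det B %% p%:Z)%Z.

Definition newton_polyhedron (p : nat) sigma : set 'rV[R]_d :=
  convex_hull
    (\bigcup_(h in [set h : 'I_d -> 'rV[int]_d |
                     (forall i, hilbert_basis (dual_cone sigma) (h i)) /\
                     det_mod p (columns h) != 0])
       [set of_lattice (\sum_(i < d) h i) + y | y in dual_cone sigma]).

End Defs.

(* Main.v *)
(** Let [h_1, ..., h_d] be linearly independent elements of the Hilbert basis of
    the dual cone, of sum [s], and let [D = |det h|]. If [D > 1], some nonzero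
    [g] in [M] has all its coordinates [l_i] with respect to [h] in [[0, 1)];
    one that minimizes [sum l_i] is irreducible in the cone generated by [h],
    so by condition (ii) it lies in the Hilbert basis, hence by condition (i)
    on a compact face [u = b] of [Gamma_plus]. Compactness forces [b > 0], and
    [b = u(g) = sum l_i u(h_i) >= b sum l_i] gives [sum l_i <= 1]. Then
    [s = sum_i (l_i / L) (s + g - h_i) + (1 / L - 1) g], with [L = sum l_i],
    exhibits [s] as a point of the hull of the translates attached to the bases
    obtained by replacing [h_i] by [g], whose determinants are [+- l_i D].
    By induction on [D], every translate lies in the hull of the translates
    given by unimodular bases, which stay bases modulo every prime. *)
Require Import Defs.
From mathcomp Require Import all_boot all_order all_algebra.
From mathcomp Require Import all_classical all_reals all_analysis.
From mathcomp Require Import ring.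
Import Order.TTheory GRing.Theory Num.Theory numFieldNormedType.Exports.

Set Implicit Arguments.
Unset Strict Implicit.
Unset Printing Implicit Defensive.

Local Open Scope classical_set_scope.
Local Open Scope ring_scope.

Lemma scalemx_inj (S : idomainType) (m n : nat) (c : S) :
  c != 0 -> injective (fun A : 'M[S]_(m, n) => c *: A).
Proof.
move=> c0 A B /matrixP E; apply/matrixP => i j.
by have := E i j; rewrite !mxE; apply: mulfI.
Qed.

(** * Integral coordinates by Cramer's rule *)

Section Cramer.
Variable d : nat.
Implicit Types (h : 'I_d -> 'rV[int]_d) (a b : 'rV[int]_d).

(** Rows instead of columns, so that [c *m generator_mx h] is the combination of the vectors [h i]
    with coefficients [c]. *)
Definition generator_mx h : 'M[int]_d := \matrix_i h i.

Definition replace h (i : 'I_d) a (j : 'I_d) := if j == i then a else h j.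

(* The coordinates of [a] in the basis [h], multiplied by [|det h|]. *)
Definition cramer h a : 'rV[int]_d :=
  Num.sg (\det (generator_mx h)) *: (a *m \adj (generator_mx h)).

Lemma det_columns h : \det (columns h) = \det (generator_mx h).
Proof.
by rewrite -det_tr; congr (\det _); apply/matrixP => i j; rewrite !mxE.
Qed.

Lemma cramerB h a b : cramer h (a - b) = cramer h a - cramer h b.
Proof. by rewrite /cramer mulmxBl scalerBr. Qed.

Lemma cramerD h a b : cramer h (a + b) = cramer h a + cramer h b.
Proof. by rewrite /cramer mulmxDl scalerDr. Qed.

Lemma cramer_mul h a : cramer h (a *m generator_mx h) =
  `|\det (generator_mx h)| *: a.
Proof.
by rewrite /cramer -mulmxA mul_mx_adj mul_mx_scalar scalerA normrEsg.
Qed.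

Lemma cramerK h a : cramer h a *m generator_mx h =
  `|\det (generator_mx h)| *: a.
Proof.
by rewrite /cramer -scalemxAl -mulmxA mul_adj_mx mul_mx_scalar scalerA normrEsg.
Qed.

(** Cramer's rule: expand along row [i], whose cofactors do not see the replaced row. Small
    coordinates thus become small determinants after an exchange. *)
Lemma cramer_replace h i a : cramer h a 0 i =
  Num.sg (\det (generator_mx h)) * \det (generator_mx (replace h i a)).
Proof.
rewrite !mxE; congr (_ * _); rewrite (expand_det_row _ i); apply: eq_bigr => k _.
rewrite !mxE /replace eqxx; congr (_ * _); rewrite /cofactor.
congr (_ * \det _); apply/matrixP => u v.
by rewrite !mxE eq_sym (negbTE (neq_lift _ _)).
Qed.

Lemma cramer_eq0 h a : \det (generator_mx h) != 0 -> cramer h a = 0 -> a = 0.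
Proof.
move=> D0 a0; have D'0 : `|\det (generator_mx h)| != 0 by rewrite normr_eq0.
by apply: (scalemx_inj D'0); rewrite -cramerK a0 mul0mx scaler0.
Qed.

(* If all the fractional parts vanish, the adjugate is divisible by the
   determinant, hence the matrix is unimodular. *)
Lemma fractional_point h : \det (generator_mx h) != 0 ->
    `|\det (generator_mx h)| != 1 ->
  exists2 a, a != 0 &
    forall i, 0 <= cramer h a 0 i < `|\det (generator_mx h)|.
Proof.
move=> D0 D1; set D : int := `|\det _| in D1 *.
have Dgt0 : 0 < D by rewrite normr_gt0.
pose e (k : 'I_d) : 'rV[int]_d := delta_mx 0 k.
have [divD|] := boolP [forall k, forall i, (D %| cramer h (e k) 0%R i)%Z].
  suff: D == 1 by rewrite (negbTE D1).
  pose C : 'M[int]_d := \matrix_(k, i) (cramer h (e k) 0%R i %/ D)%Z.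
  have CK : C *m generator_mx h = 1%:M.
    apply/row_matrixP => k; rewrite row_mul rowE.
    apply: (scalemx_inj (lt0r_neq0 Dgt0)); rewrite /= scalemxAl.
    have -> : D *: (delta_mx 0 k *m C) = cramer h (e k).
      apply/rowP => i; rewrite -rowE.
      have /forallP/(_ k)/forallP/(_ i) := divD.
      by rewrite !mxE => dv; rewrite mulrC; apply: divzK dv.
    by rewrite cramerK rowE mulmx1.
  have : \det (generator_mx h) \is a GRing.unit.
    by apply/unitrPr; exists (\det C); rewrite mulrC -det_mulmx CK det1.
  by rewrite /D => /orP[] /eqP ->.
rewrite negb_forall => /existsP [k]; rewrite negb_forall => /existsP [i0 nd].
(* Removing the integral part [q] of the coordinates of [e k] leaves their remainders modulo [D];
   the one at [i0] is nonzero, hence so is [a]. *)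
pose q : 'rV[int]_d := \row_i (cramer h (e k) 0%R i %/ D)%Z.
pose a := e k - q *m generator_mx h.
have aE i : cramer h a 0 i = (cramer h (e k) 0%R i %% D)%Z.
  rewrite cramerB cramer_mul /modz /= -/D mulrC.
  by rewrite /q; move: (cramer h (e k)) => c; rewrite !mxE.
exists a.
  apply: contra nd => /eqP a0; apply/dvdz_mod0P; rewrite -aE a0.
  by rewrite /cramer mul0mx scaler0 mxE.
by move=> i; rewrite aE modz_ge0 ?lt0r_neq0 // ltz_pmod.
Qed.

End Cramer.

(** * Simplicial cones and their Hilbert bases *)

Section Cones.
Variables (R : realType) (d : nat).
Implicit Types (h : 'I_d -> 'rV[int]_d) (g m : 'rV[int]_d).
Local Notation of_lattice := (@of_lattice R d).

Lemma of_lattice0 : of_lattice 0 = 0.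
Proof. exact: map_mx0. Qed.

Lemma of_latticeD m g : of_lattice (m + g) = of_lattice m + of_lattice g.
Proof. exact: map_mxD. Qed.

Lemma of_latticeZ (c : int) m : of_lattice (c *: m) = c%:~R *: of_lattice m.
Proof. exact: map_mxZ. Qed.

Lemma of_lattice_comb h (c : 'rV[int]_d) :
  of_lattice (c *m generator_mx h) = \sum_i (c 0 i)%:~R *: of_lattice (h i).
Proof.
apply/rowP => j; rewrite !mxE summxE rmorph_sum; apply: eq_bigr => i _.
by rewrite !mxE rmorphM.
Qed.

(** A conic combination may repeat or omit generators; its coefficients are collected by index after
    choosing preimages. *)
Lemma simplicial_cone_gen h (x : 'rV[R]_d) :
  cone_gen (of_lattice @` range h) x <->
  exists2 c : 'I_d -> R,
    forall i, 0 <= c i & x = \sum_i c i *: of_lattice (h i).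
Proof.
split=> [[k [c [a [c0 aP ->]]]]|[c c0 ->]]; last first.
  exists d, c, (of_lattice \o h); split => // i.
  by exists (h i) => //; exists i.
have /choice[f fE] : forall l, exists i, of_lattice (h i) = a l.
  by move=> l; have [_ [i _ <-] <-] := aP l; exists i.
exists (fun i => \sum_(l | f l == i) c l) => [i|]; first exact: sumr_ge0.
rewrite (partition_big f xpredT) //=; apply: eq_bigr => i _.
by rewrite scaler_suml; apply: eq_bigr => l /eqP <-; rewrite fE.
Qed.

(** Independence makes the real coordinates of [m] unique, and [cramer h m] is a positive multiple
    of them. *)
Lemma simplicial_coneP h m : \det (generator_mx h) != 0 ->
  cone_gen (of_lattice @` range h) (of_lattice m) <->
  forall i, 0 <= cramer h m 0 i.
Proof.
move=> D0; rewrite simplicial_cone_gen; set D : int := `|\det (generator_mx h)|.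
have Dgt0 : 0 < D%:~R :> R by rewrite ltr0z normr_gt0.
split=> [[c c0 mE] i|c0].
  suff E : (cramer h m 0 i)%:~R = D%:~R * c i :> R.
    have : 0 <= (cramer h m 0 i)%:~R :> R by rewrite E mulr_ge0 // ltW.
    by rewrite ler0z.
  have mE' : of_lattice m = (\row_i c i) *m map_mx intr (generator_mx h).
    rewrite mE; apply/rowP => j; rewrite summxE !mxE; apply: eq_bigr => k _.
    by rewrite !mxE.
  have : map_mx intr (cramer h m) = D%:~R *: (\row_i c i) :> 'rV[R]_d.
    rewrite /cramer map_mxZ map_mxM map_mx_adj -/(of_lattice m) mE' -mulmxA.
    rewrite mul_mx_adj mul_mx_scalar det_map_mx scalerA /D normrEsg.
    by rewrite rmorphM.
  by move/rowP/(_ i); rewrite !mxE.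
exists (fun i => (cramer h m 0 i)%:~R / D%:~R) => [i|].
  by apply: divr_ge0; [rewrite ler0z | exact: ltW].
apply: (scalerI (lt0r_neq0 Dgt0)).
transitivity (of_lattice (D *: m)); first by rewrite of_latticeZ.
rewrite -cramerK of_lattice_comb scaler_sumr; apply: eq_bigr => i _.
by rewrite scalerA mulrC divfK ?lt0r_neq0.
Qed.

(** Peel a sum of generators term by term: irreducibility makes the first term or the rest vanish.
    As this applies to every generating set, [g] lies in their intersection. *)
Lemma irreducible_generates (S H : set 'rV[int]_d) g : generates S H ->
  S g -> g != 0 -> (forall a b, S a -> S b -> g = a + b -> a = 0 \/ b = 0) ->
  H g.
Proof.
move=> SE Sg g0 irr; move: Sg; rewrite {1}SE => -[s [sH gE]].
elim: s sH gE => [|x s IH] sH gE; first by rewrite gE big_nil eqxx in g0.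
have sH' : [set` s] `<=` H by move=> y ys; apply: sH; rewrite /= inE ys orbT.
have Hx : H x by apply: sH; rewrite /= inE eqxx.
have Sx : S x.
  rewrite SE; exists [:: x]; rewrite big_seq1; split => // y.
  by rewrite /= inE => /eqP ->.
have Ss : S (\sum_(y <- s) y) by rewrite SE; exists s.
rewrite big_cons in gE; have [x0|s0] := irr _ _ Sx Ss gE.
  by apply: IH => //; rewrite gE x0 add0r.
by rewrite gE s0 addr0.
Qed.

Lemma hilbert_basis_sub (tau : set 'rV[R]_d) : tau 0 ->
  (forall x y, tau x -> tau y -> tau (x + y)) ->
  hilbert_basis tau `<=` lattice_points tau.
Proof.
move=> tau0 tauD; apply: smallest_sub; last exact: sub0set.
rewrite /generates; apply/seteqP; split=> m /= => [mS|[s [sS ->]]].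
  exists [:: m]; rewrite big_seq1; split => // y.
  by rewrite /= inE => /eqP ->.
have lp0 : lattice_points tau (0 : 'rV[int]_d).
  by rewrite /lattice_points /= of_lattice0.
elim: s sS => [|x s IH] sS; first by rewrite big_nil.
rewrite big_cons /lattice_points /= of_latticeD; apply: tauD.
  by apply: (sS x); rewrite /= inE eqxx.
by apply: IH => y ys; apply: sS; rewrite /= inE ys orbT.
Qed.

Lemma fractional_hilbert_basis h : \det (generator_mx h) != 0 ->
    `|\det (generator_mx h)| != 1 ->
  exists g, [/\ hilbert_basis (cone_gen (of_lattice @` range h)) g, g != 0 &
    forall i, 0 <= cramer h g 0 i < `|\det (generator_mx h)|].
Proof.
move=> D0 D1; have [a] := fractional_point D0 D1.
have [n] := ubnP `|(\sum_i cramer h a 0 i)%R|%N.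
elim: n a => // n IH a an a0 aP.
(* In a nontrivial splitting [a = b + c], the coordinates of [b] stay below the determinant and
   their sum drops, since [c] has a positive coordinate. *)
have [[b [c [b0 c0 bP cP aE]]]|irr] := pselect (exists b c,
    [/\ b != 0, c != 0, forall i, 0 <= cramer h b 0 i,
        forall i, 0 <= cramer h c 0 i & a = b + c]).
  have aE' i : cramer h a 0 i = cramer h b 0 i + cramer h c 0 i.
    by rewrite aE cramerD mxE.
  apply: (IH b) => // [|i]; last first.
    rewrite bP; case/andP: (aP i) => _; apply: le_lt_trans.
    by rewrite aE' lerDl.
  move: an; rewrite ltnS; apply: leq_trans; rewrite -ltz_nat !gez0_abs.
  - under [X in _ < X]eq_bigr do rewrite aE'.
    rewrite big_split /= ltrDl lt_neqAle sumr_ge0 // andbT eq_sym.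
    apply: contra c0 => /eqP cs0; apply/eqP; apply: (cramer_eq0 D0).
    apply/rowP => i.
    by rewrite (psumr_eq0P (P := xpredT) (fun i _ => cP i) cs0) // mxE.
  - by apply: sumr_ge0 => i _; case/andP: (aP i).
  - exact: sumr_ge0.
exists a; split => // H [genH _].
apply: (irreducible_generates genH) => //.
  by rewrite /lattice_points /= simplicial_coneP // => i; case/andP: (aP i).
move=> b c; rewrite /lattice_points /= !simplicial_coneP // => bP cP aE.
have [->|b0] := eqVneq b 0; first by left.
have [->|c0] := eqVneq c 0; first by right.
by case: irr; exists b, c.
Qed.

(** * Barycentres and compact faces *)

Lemma convex_set_bary (I : finType) (C : set 'rV[R]_d) (w : I -> R)
    (x : I -> 'rV[R]_d) : @convex_set R 'rV[R]_d C ->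
  (forall i, 0 <= w i) -> (forall i, 0 < w i -> C (x i)) ->
  0 < \sum_i w i -> C ((\sum_i w i)^-1 *: \sum_i w i *: x i).
Proof.
move=> convC w0 wC.
(* [K] is the cone over [C] placed at height 1, apex included, so that partial sums of zero weights
   are allowed. *)
pose K r v := (r = 0 /\ v = 0) \/ (0 < r /\ C (r^-1 *: v)).
have : K (\sum_i w i) (\sum_i w i *: x i).
  elim/big_rec2: _ => [|i v r _ IH]; first by left.
  have [wi0|wi_neq0] := eqVneq (w i) 0; first by rewrite wi0 scale0r !add0r.
  have wi_gt0 : 0 < w i by rewrite lt_neqAle eq_sym wi_neq0 w0.
  case: IH => [[-> ->]|[r0 Cv]]; right.
    by rewrite !addr0 scalerA mulVf // scale1r; split => //; apply: wC.
  have s0 : 0 < w i + r by rewrite addr_gt0.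
  have t0 : 0 <= w i / (w i + r) by rewrite divr_ge0 // ltW.
  have t1 : w i / (w i + r) <= 1 by rewrite ler_pdivrMr // mul1r lerDl ltW.
  split => //.
  have := convC (x i) (r^-1 *: v) (Itv01 t0 t1)
    (mem_set (wC _ wi_gt0)) (mem_set Cv).
  move/set_mem; congr C; rewrite /conv /= scalerDr !scalerA mulrC.
  congr (_ + _ *: _).
  rewrite /unstable.onem; field.
  by rewrite !lt0r_neq0.
by case=> [[-> _]|[]]; rewrite ?ltxx.
Qed.

Lemma pairing_suml (I : finType) (c : I -> R) (a : I -> 'rV[R]_d) u :
  pairing (\sum_i c i *: a i) u = \sum_i c i * pairing (a i) u.
Proof.
rewrite /pairing; under eq_bigr do rewrite summxE mulr_suml.
rewrite exchange_big; apply: eq_bigr => i _; rewrite mulr_sumr.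
by apply: eq_bigr => j _; rewrite !mxE mulrA.
Qed.

Lemma pairingZ (c : R) (a u : 'rV[R]_d) : pairing (c *: a) u = c * pairing a u.
Proof.
by rewrite /pairing mulr_sumr; apply: eq_bigr => j _; rewrite !mxE mulrA.
Qed.

(** If [b] were negative, [2 x] would fall below it; if it were zero, the face would contain all
    positive integer multiples of [x] and be unbounded. *)
Lemma compact_face_height (P : set 'rV[R]_d) (u x : 'rV[R]_d) (b : R) :
  (forall y, P y -> b <= pairing y u) ->
  compact (P `&` [set y | pairing y u = b]) ->
  x != 0 -> pairing x u = b -> (forall k, P (k.+1%:R *: x)) -> 0 < b.
Proof.
move=> Pb cF x0 xb Px; rewrite ltNge; apply/negP => b_le0.
have b0 : b = 0.
  apply/eqP; rewrite eq_le b_le0 /=; have := Pb _ (Px 1%N).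
  by rewrite pairingZ xb mulr2n mulrDl mul1r lerDl.
have [M [_ /(_ (M + 1))]] := compact_bounded cF.
rewrite ltrDl ltr01 => /(_ isT) FM.
have nx : 0 < `|x| by rewrite normr_gt0.
have M0 : 0 <= (M + 1) / `|x|.
  rewrite divr_ge0 //; apply: le_trans (FM x _); first exact: normr_ge0.
  by split => //; have := Px 0%N; rewrite scale1r.
have := archi_boundP M0; set k := Num.Def.archi_bound _.
rewrite ltr_pdivrMr //; apply/negP; rewrite -leNgt.
apply: le_trans (FM (k.+1%:R *: x) _).
  by rewrite normrZ ger0_norm // ler_wpM2r // ler_nat.
by split=> //=; rewrite pairingZ xb b0 mulr0.
Qed.

(** * Descent on the determinant under stability *)

Section Stable.
Variable tau : set 'rV[R]_d.
Hypotheses (tau0 : tau 0) (tauD : forall x y, tau x -> tau y -> tau (x + y))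
  (tauZ : forall (c : R) x, 0 <= c -> tau x -> tau (c *: x)).
Hypothesis tau_stable : G_stable tau.

Lemma stable_fractional_sum h g :
  (forall i, hilbert_basis tau (h i)) -> hilbert_basis tau g -> g != 0 ->
  (forall i, 0 <= cramer h g 0 i) ->
  \sum_i cramer h g 0 i <= `|\det (generator_mx h)|.
Proof.
move=> hH gH g0 c0; set D : int := `|_|.
have [F [[u [b [Pb FE]]] cF] Fg] : Gamma tau (of_lattice g).
  by move: gH; rewrite (proj1 tau_stable).
have hb i : b <= pairing (of_lattice (h i)) u.
  (* Condition (i) puts [h i] on some face of [Gamma_plus tau], hence in [Gamma_plus tau], where [b]
     bounds [u] from below. *)
  apply: Pb; have := hH i; rewrite (proj1 tau_stable).
  by case=> F' [[u' [b' [_ ->]]] _] [].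
rewrite FE in Fg cF; case: Fg => _ gb.
have b0 : 0 < b.
  apply: (compact_face_height Pb cF _ gb).
    apply: contra g0 => /eqP/rowP g0; apply/eqP/rowP => j.
    by have := g0 j; rewrite !mxE => /eqP; rewrite intr_eq0 => /eqP.
  move=> k; apply: sub_gen_smallest; exists (k.+1%:R *: g) => /=.
    split=> /=.
      rewrite /lattice_points /= of_latticeZ.
      apply: tauZ; first by rewrite ler0z.
      exact: (hilbert_basis_sub tau0 tauD gH).
    have k0 : (k.+1%:R : int) != 0 by rewrite pnatr_eq0.
    move=> E; move/eqP: g0; apply.
    by apply: (scalemx_inj k0); rewrite /= E scaler0.
  by rewrite of_latticeZ rmorph_nat.
have DgE : D%:~R * b =
    \sum_i (cramer h g 0 i)%:~R * pairing (of_lattice (h i)) u.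
  by rewrite -gb -pairingZ -of_latticeZ -cramerK of_lattice_comb pairing_suml.
rewrite -(ler_int R) -(ler_pM2r b0) DgE rmorph_sum mulr_suml.
by apply: ler_sum => i _; rewrite ler_wpM2l // ler0z.
Qed.

(** The convex set [C] stays fixed during the induction, while [y] varies: each exchange shifts it
    by a multiple of [g]. *)
Lemma translate_sub_convex (C : set 'rV[R]_d) : @convex_set R 'rV[R]_d C ->
  (forall h y, (forall i, hilbert_basis tau (h i)) ->
     `|\det (generator_mx h)| = 1 -> tau y ->
     C (of_lattice (\sum_i h i) + y)) ->
  forall h y, (forall i, hilbert_basis tau (h i)) ->
     \det (generator_mx h) != 0 -> tau y -> C (of_lattice (\sum_i h i) + y).
Proof.
move=> convC unimodularC h.
have [n] := ubnP `|(\det (generator_mx h))%R|%N.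
elim: n h => // n IH h hn y hH D0 tauy.
have [D1|D1] := eqVneq `|\det (generator_mx h)| 1; first exact: unimodularC.
have rangeH : range h `<=` hilbert_basis tau by move=> _ [i _ <-].
have [g [gH g0 gP]] := fractional_hilbert_basis D0 D1.
rewrite (proj2 tau_stable _ rangeH) in gH; case: gH => gH _.
have c0 i : 0 <= cramer h g 0 i by case/andP: (gP i).
have LD := stable_fractional_sum hH gH g0 c0.
set D : int := `|_| in gP LD; set L := \sum_i _ in LD.
have L0 : 0 < L.
  rewrite lt_neqAle sumr_ge0 // andbT eq_sym; apply: contra g0 => /eqP Leq0.
  apply/eqP/(cramer_eq0 D0)/rowP => i.
  by rewrite (psumr_eq0P (P := xpredT) (fun i _ => c0 i) Leq0) // mxE.
have Lr0 : 0 < L%:~R :> R by rewrite ltr0z.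
(* With weights [cramer h g 0 i / L], the exchanged sums have barycentre [s + g - (D / L) g], where
   [s] is the sum of the [h j]. The shift in [z] compensates, and [z] stays in [tau] because
   [L <= D]. *)
pose z := y + (D%:~R / L%:~R - 1) *: of_lattice g.
have tauz : tau z.
  apply: tauD => //; apply: tauZ; last exact: (hilbert_basis_sub tau0 tauD gH).
  by rewrite subr_ge0 ler_pdivlMr // mul1r ler_int.
have LE : \sum_i (cramer h g 0 i)%:~R = L%:~R :> R by rewrite rmorph_sum.
(* A zero coordinate would make the exchanged family singular, so only positive weights count; the
   new determinant is then, up to sign, a coordinate below [D]. *)
have wC i : 0 < (cramer h g 0 i)%:~R :> R ->
    C (of_lattice (\sum_j replace h i g j) + z).
  rewrite ltr0z => ci; have detE := cramer_replace h i g; apply: IH => //.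
  - move: hn; rewrite ltnS; apply: leq_trans; rewrite -ltz_nat !abszE -/D.
    case/andP: (gP i) => _; rewrite -[X in X < _]ger0_norm // detE normrM.
    by rewrite normr_sg D0 mul1r.
  - by move=> j; rewrite /replace; case: eqP.
  - by apply: contraTneq ci => E; rewrite detE E mulr0 ltxx.
have := convex_set_bary convC _ wC; rewrite LE => /(_ _ Lr0).
have w0 i : 0 <= (cramer h g 0 i)%:~R :> R by rewrite ler0z.
move=> /(_ w0); congr C; apply: (scalemx_inj (lt0r_neq0 Lr0)) => /=.
rewrite scalerA mulfV ?lt0r_neq0 // scale1r.
(* Each exchange changes the sum by [g - h i], and the weighted [h i] add up to [D g]. *)
transitivity (L%:~R *: (of_lattice (\sum_j h j) + of_lattice g + z)
    - of_lattice (D *: g)).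
  rewrite -cramerK of_lattice_comb -LE scaler_suml -sumrB.
  apply: eq_bigr => i _; rewrite -scalerBr; congr (_ *: _).
  rewrite addrAC; congr (_ + _); apply/eqP; rewrite eq_sym subr_eq; apply/eqP.
  rewrite -!of_latticeD; congr of_lattice.
  rewrite (bigD1 i) // [X in _ = X + _](bigD1 i) //= /replace eqxx.
  rewrite addrAC [RHS]addrAC [h i + g]addrC; congr (_ + _).
  by apply: eq_bigr => j /negbTE ->.
rewrite of_latticeZ /z; apply/rowP => j; rewrite !mxE; field.
by rewrite lt0r_neq0.
Qed.

End Stable.

End Cones.

(** * Dual cones and comparison of the two polyhedra *)

Lemma dual_cone0 (R : realType) d (sigma : set 'rV[R]_d) : dual_cone sigma 0.
Proof.
by move=> n _; rewrite /pairing big1 // => i _; rewrite mxE mul0r.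
Qed.

Lemma dual_coneD (R : realType) d (sigma : set 'rV[R]_d) x y :
  dual_cone sigma x -> dual_cone sigma y -> dual_cone sigma (x + y).
Proof.
move=> sx sy n sn; have := addr_ge0 (sx n sn) (sy n sn).
rewrite /pairing -big_split /= => H; under eq_bigr do rewrite mxE mulrDl.
exact: H.
Qed.

Lemma dual_coneZ (R : realType) d (sigma : set 'rV[R]_d) (c : R) x :
  0 <= c -> dual_cone sigma x -> dual_cone sigma (c *: x).
Proof. by move=> c0 sx n sn; rewrite pairingZ mulr_ge0 // sx. Qed.

Lemma convex_set_hull (R : realType) d (A : set 'rV[R]_d) :
  @convex_set R 'rV[R]_d (convex_hull A).
Proof.
move=> x y l /set_mem xA /set_mem yA; apply/mem_set => B [convB AB].
have hullB : convex_hull A `<=` B by apply: smallest_sub.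
by apply/set_mem/convB; apply/mem_set/hullB.
Qed.

Theorem theorem2p16 (R : realType) (d : nat) (sigma : set 'rV[R]_d)
    (rational_sigma : rational_polyhedral_cone sigma)
    (convex_sigma : strongly_convex sigma)
    (full_sigma : full_dimensional sigma)
    (stable_dual : G_stable (dual_cone sigma))
    (p : nat) (prime_p : prime p) :
  newton_polyhedron 0 sigma = newton_polyhedron p sigma.
Proof.
apply/seteqP; split; last first.
  (* A determinant that is nonzero modulo [p] is nonzero, so the translates for [p] are among those
     for [0]. *)
  apply: sub_smallest2r; first exact: convex_set_hull.
  move=> x [h [hH detp] hx]; exists h => //; split => //.
  by apply: contra detp; rewrite /det_mod modz0 => /eqP ->; rewrite mod0z.
apply: smallest_sub; first exact: convex_set_hull.
move=> _ [h [hH det0] [y tauy <-]].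
apply: (translate_sub_convex (@dual_cone0 R d sigma) (@dual_coneD R d sigma)
  (@dual_coneZ R d sigma) stable_dual (@convex_set_hull R d _)) => //; last first.
  by rewrite -det_columns -[\det _]modz0.
(* A determinant of absolute value 1 is not divisible by [p], so unimodular translates already occur
   for [p]. *)
move=> k z kH det1 tauz; apply: sub_gen_smallest.
exists k; last by exists z.
split => //; rewrite /det_mod det_columns; apply/eqP => /dvdz_mod0P.
rewrite dvdzE; move: det1; rewrite -abszE => -[->].
by rewrite dvdn1 /= => /eqP p1; move: prime_p; rewrite p1.
Qed.
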